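(* Let $\mathcal{A}\in\mathbb{R}^{l\times m\times n}$ be a tensor of multilinear rank $\operatorname{rank}(\mathcal{A})=(p,q,r)$ with $p\le q\le r$, and write $\mathcal{A}=(X,Y,Z)\cdot\mathcal{C}$, where $\mathcal{C}$ is a $p\times q\times r$ tensor and $X\in\mathbb{R}^{l\times p}$, $Y\in\mathbb{R}^{m\times q}$, $Z\in\mathbb{R}^{n\times r}$ are full column rank matrices. Assume that the starting vectors satisfy $u_1\in\operatorname{span}(X)$, $v_1\in\operatorname{span}(Y)$ and $w_1\in\operatorname{span}(Z)$. Assume also that the modified minimal Krylov recursion applied to $\mathcal{A}$ does not break down except when a set of vectors spanning the full range space of the mode in question has been obtained. Then, in exact arithmetic and in a total of $r$ steps, the modified minimal Krylov recursion produces matrices $U_p=[u_1\,\cdots\,u_p]$, $V_q=[v_1\,\cdots\,v_q]$ and $W_r=[w_1\,\cdots\,w_r]$ which span the same subspaces as $X$, $Y$ and $Z$, respectively, i.e. $\operatorname{span}(U_p)=\operatorname{span}(X)$, $\operatorname{span}(V_q)=\operatorname{span}(Y)$, $\operatorname{span}(W_r)=\operatorname{span}(Z)$.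
   Context: All tensors are real arrays of order three, and $\operatorname{span}(M)$ of a matrix $M$ denotes its column space. Tensor-matrix multiplication: for $\mathcal{C}\in\mathbb{R}^{p\times q\times r}$ and $X\in\mathbb{R}^{l\times p}$, $Y\in\mathbb{R}^{m\times q}$, $Z\in\mathbb{R}^{n\times r}$, $(X,Y,Z)\cdot\mathcal{C}\in\mathbb{R}^{l\times m\times n}$ has entries $\sum_{\alpha,\beta,\gamma}x_{i\alpha}y_{j\beta}z_{k\gamma}c_{\alpha\beta\gamma}$. For $u\in\mathbb{R}^l$, $v\in\mathbb{R}^m$, $w\in\mathbb{R}^n$, define $$(\mathcal{A}\cdot(v,w)_{2,3})_i=\sum_{j,k}a_{ijk}v_jw_k,\quad (\mathcal{A}\cdot(u,w)_{1,3})_j=\sum_{i,k}a_{ijk}u_iw_k,\quad (\mathcal{A}\cdot(u,v)_{1,2})_k=\sum_{i,j}a_{ijk}u_iv_j,$$ vectors in $\mathbb{R}^l$, $\mathbb{R}^m$, $\mathbb{R}^n$ respectively. Multilinear rank: $\operatorname{rank}(\mathcal{A})=(p,q,r)$ means that the spans of the mode-1 fibres $\mathcal{A}(:,j,k)$, of the mode-2 fibres $\mathcal{A}(i,:,k)$ and of the mode-3 fibres $\mathcal{A}(i,j,:)$ (the range spaces of the three modes) have dimensions $p$, $q$, $r$ respectively. Minimal Krylov recursion: given unit vectors $u_1\in\mathbb{R}^l$, $v_1\in\mathbb{R}^m$, set $\alpha_w w_1=\mathcal{A}\cdot(u_1,v_1)_{1,2}$. With $U_i=[u_1\,\cdots\,u_i]$,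 $V_i=[v_1\,\cdots\,v_i]$, $W_i=[w_1\,\cdots\,w_i]$, for $i=1,2,\dots$ compute in order: (1) $\widehat u=\mathcal{A}\cdot(v_i,w_i)_{2,3}$ and $\alpha_u u_{i+1}=\widehat u-U_iU_i^{\mathsf T}\widehat u$; (2) $\widehat v=\mathcal{A}\cdot(u_{i+1},w_i)_{1,3}$ and $\alpha_v v_{i+1}=\widehat v-V_iV_i^{\mathsf T}\widehat v$; (3) $\widehat w=\mathcal{A}\cdot(u_{i+1},v_{i+1})_{1,2}$ and $\alpha_w w_{i+1}=\widehat w-W_iW_i^{\mathsf T}\widehat w$. The scalars $\alpha_u,\alpha_v,\alpha_w$ (depending on $i$) normalize the generated vectors to length one. Modified minimal Krylov recursion (for $\operatorname{rank}(\mathcal{A})=(p,q,r)$, $p\le q\le r$): (a) Run the minimal Krylov recursion for $p$ steps, obtaining $u_1,\dots,u_p$, $v_1,\dots,v_p$, $w_1,\dots,w_p$. After this no new vector can be generated in the first mode (the result of the orthogonalization is zero). (b) Continue generating only mode-2 and mode-3 vectors in the same way, where the first-mode vector used in each product is any of the vectors $u_1,\dots,u_p$ or a (possibly random) linear combination of them, until $q$ vectors have been generated in the second and third modes. (c) Generate the final $r-q$ mode-3 vectors by $\widehat w=\mathcal{A}\cdot(\bar u,\bar v)_{1,2}$, $\alpha_w w_{i+1}=\widehat w-W_iW_i^{\mathsf T}\widehat w$, where $(\bar u,\bar v)$ is a combination of a mode-1 and a mode-2 vector that has not been used before or, alternatively, a pair of (random) linear combinations of the previously generated mode-1 and mode-2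 vectors, respectively. Every newly generated vector is orthogonalized against all previous vectors in its mode and normalized to length one. A total of $r$ steps means that $w_1,\dots,w_r$ have been generated. A break down occurs when a newly generated vector (before orthogonalization) is a linear combination of the previously generated vectors in its mode. *)

(* Defs.v *)
From HB Require Import structures.
From mathcomp Require Import all_boot all_order all_algebra.
From mathcomp Require Import reals.

Set Implicit Arguments.
Unset Strict Implicit.
Unset Printing Implicit Defensive.
Import Order.TTheory GRing.Theory Num.Theory.
Local Open Scope ring_scope.

Notation tensor R l m n := {ffun 'I_l * 'I_m * 'I_n -> R}.

Section TensorAlgebra.
Variable R : realType.

Definition colspan (d k : nat) (M : 'M[R]_(d, k)) : {vspace 'cV[R]_d} :=
  <<[seq col j M | j : 'I_k]>>%VS.

(* Euclidean norm (the library's norm on matrices is the sup norm) *)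
Definition vnorm (d : nat) (x : 'cV[R]_d) : R :=
  Num.sqrt (\sum_i x i 0 ^+ 2).

Section Ops.
Variables l m n : nat.

Definition tmul (p q r : nat) (X : 'M[R]_(l, p)) (Y : 'M[R]_(m, q))
    (Z : 'M[R]_(n, r)) (C : tensor R p q r) : tensor R l m n :=
  [ffun ijk => \sum_(a < p) \sum_(b < q) \sum_(c < r)
     X ijk.1.1 a * Y ijk.1.2 b * Z ijk.2 c * C (a, b, c)].

Implicit Type A : tensor R l m n.

Definition contract23 A (v : 'cV[R]_m) (w : 'cV[R]_n) : 'cV[R]_l :=
  \col_i \sum_j \sum_k A (i, j, k) * v j 0 * w k 0.
Definition contract13 A (u : 'cV[R]_l) (w : 'cV[R]_n) : 'cV[R]_m :=
  \col_j \sum_i \sum_k A (i, j, k) * u i 0 * w k 0.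
Definition contract12 A (u : 'cV[R]_l) (v : 'cV[R]_m) : 'cV[R]_n :=
  \col_k \sum_i \sum_j A (i, j, k) * u i 0 * v j 0.

Definition fibre1 A (j : 'I_m) (k : 'I_n) : 'cV[R]_l := \col_i A (i, j, k).
Definition fibre2 A (i : 'I_l) (k : 'I_n) : 'cV[R]_m := \col_j A (i, j, k).
Definition fibre3 A (i : 'I_l) (j : 'I_m) : 'cV[R]_n := \col_k A (i, j, k).

Definition range1 A : {vspace 'cV[R]_l} :=
  <<[seq fibre1 A jk.1 jk.2 | jk : 'I_m * 'I_n]>>%VS.
Definition range2 A : {vspace 'cV[R]_m} :=
  <<[seq fibre2 A ik.1 ik.2 | ik : 'I_l * 'I_n]>>%VS.
Definition range3 A : {vspace 'cV[R]_n} :=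
  <<[seq fibre3 A ij.1 ij.2 | ij : 'I_l * 'I_m]>>%VS.

Definition multilinear_rank A : nat * nat * nat :=
  (\dim (range1 A), \dim (range2 A), \dim (range3 A)).

End Ops.
End TensorAlgebra.

(* A family of vectors x_1, x_2, ... is a function x : nat -> 'cV[R]_d whose
   value at 0 is irrelevant.  The family xh holds the corresponding vectors
   before orthogonalization and normalization. *)
Section Recursion.
Variable R : realType.

Section OneMode.
Variable d : nat.
Implicit Types (x xh : nat -> 'cV[R]_d) (e : 'cV[R]_d).

(* [x_1 ... x_i] *)
Definition cols x (i : nat) : 'M[R]_(d, i) := \matrix_(a < d, j < i) x j.+1 a 0.

Definition orth x (i : nat) e : 'cV[R]_d :=
  e - cols x i *m (cols x i)^T *m e.

(* x_{i+1} is obtained from the product e.  When orthogonalization yields zero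
   there is nothing to normalize: alpha may be 0 and x_{i+1} is then left
   unconstrained, so this predicate does not presuppose that the step
   succeeds. *)
Definition generate x xh (i : nat) e : Prop :=
  xh i.+1 = e /\
  exists2 alpha : R, alpha *: x i.+1 = orth x i (xh i.+1) &
    (orth x i (xh i.+1) != 0 -> vnorm (x i.+1) = 1).

(* the generation of x_{i+1} breaks down; for i = 0 this means xh_1 = 0 *)
Definition breakdown x xh (i : nat) : Prop :=
  xh i.+1 \in colspan (cols x i).

End OneMode.

Section ThreeModes.
Variables l m n : nat.
Implicit Type A : tensor R l m n.
Implicit Types (u uh : nat -> 'cV[R]_l) (v vh : nat -> 'cV[R]_m).
Implicit Types (w wh : nat -> 'cV[R]_n).

(* s steps, producing u_1, ..., u_s, v_1, ..., v_s and w_1, ..., w_s *)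
Definition minimal_krylov A (s : nat) u uh v vh w wh : Prop :=
  [/\ vnorm (u 1%N) = 1, vnorm (v 1%N) = 1,
      generate w wh 0 (contract12 A (u 1%N) (v 1%N)) &
      forall i, (0 < i < s)%N ->
        [/\ generate u uh i (contract23 A (v i) (w i)),
            generate v vh i (contract13 A (u i.+1) (w i)) &
            generate w wh i (contract12 A (u i.+1) (v i.+1))]].

(* The vectors ub, ub', vb are the free choices of the method.  In the last
   phase a pair (u_j, v_k) not used before is a particular pair of linear
   combinations, so the two alternatives together allow exactly the pairs in
   span(U_p) x span(V_q). *)
Definition modified_minimal_krylov A (p q r : nat) u uh v vh w wh : Prop :=
  [/\ minimal_krylov A p u uh v vh w wh,
      forall i, (p <= i < q)%N ->
        exists ub ub' : 'cV[R]_l,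
          [/\ ub \in colspan (cols u p), ub' \in colspan (cols u p),
              generate v vh i (contract13 A ub (w i)) &
              generate w wh i (contract12 A ub' (v i.+1))] &
      forall i, (q <= i < r)%N ->
        exists (ub : 'cV[R]_l) (vb : 'cV[R]_m),
          [/\ ub \in colspan (cols u p), vb \in colspan (cols v q) &
              generate w wh i (contract12 A ub vb)]].

Definition no_premature_breakdown A (p q r : nat) u uh v vh w wh : Prop :=
  [/\ forall i, (0 < i < p)%N ->
        breakdown u uh i -> colspan (cols u i) = range1 A,
      forall i, (0 < i < q)%N ->
        breakdown v vh i -> colspan (cols v i) = range2 A &
      forall i, (i < r)%N ->
        breakdown w wh i -> colspan (cols w i) = range3 A].

End ThreeModes.
End Recursion.

(* Main.v *)
(* Every product formed by the recursion is a combination of fibres, so it lies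
   in the range space of its mode, whichever vectors of the other two modes are
   used.  Hence the three modes decouple: as long as a mode has fewer vectors
   than the dimension of its range space, no break down can occur, so the new
   vector stays in the range space and leaves the span of the previous ones,
   and the dimension of that span reaches the dimension of the range space. *)

Require Import Defs.
From HB Require Import structures.
From mathcomp Require Import all_boot all_order all_algebra.
From mathcomp Require Import reals.

Set Implicit Arguments.
Unset Strict Implicit.
Unset Printing Implicit Defensive.
Import Order.TTheory GRing.Theory Num.Theory.
Local Open Scope ring_scope.

Section Colspan.
Variables (R : realType) (d : nat).
Implicit Types (S : {vspace 'cV[R]_d}) (x xh : nat -> 'cV[R]_d) (e : 'cV[R]_d).

Lemma mulmx_colspan k (M : 'M[R]_(d, k)) (c : 'cV[R]_k) :
  M *m c \in colspan M.
Proof.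
have -> : M *m c = \sum_j c j 0 *: col j M.
  apply/colP=> i; rewrite !mxE summxE; apply: eq_bigr => j _.
  by rewrite !mxE mulrC.
apply: memv_suml => j _; rewrite memvZ // memv_span //.
by apply/imageP; exists j.
Qed.

Lemma dim_colspan_leq k (M : 'M[R]_(d, k)) : (\dim (colspan M) <= k)%N.
Proof. by apply: leq_trans (dim_span _) _; rewrite size_image card_ord. Qed.

Lemma col_cols x i (j : 'I_i) : col j (cols x i) = x j.+1.
Proof. by apply/colP=> a; rewrite !mxE. Qed.

Lemma mem_colspan_cols x i j : (j < i)%N -> x j.+1 \in colspan (cols x i).
Proof.
move=> ji; rewrite memv_span //; apply/imageP; exists (Ordinal ji) => //.
by rewrite col_cols.
Qed.

Lemma colspan_cols_subv x i S :
  (forall j, (j < i)%N -> x j.+1 \in S) -> (colspan (cols x i) <= S)%VS.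
Proof.
by move=> xS; apply/span_subvP => _ /imageP[j _ ->]; rewrite col_cols xS.
Qed.

(** Orthogonalization subtracts [cols x i] times a vector, an element of the span, whether or not
    the columns are orthonormal. So a break down can be detected on the orthogonalized vector. *)
Lemma mem_orth x i e : (orth x i e \in colspan (cols x i)) =
  (e \in colspan (cols x i)).
Proof. by rewrite /orth -mulmxA rpredBr // mulmx_colspan. Qed.

Lemma vnorm1_neq0 e : vnorm e = 1 -> e != 0.
Proof.
move=> e1; apply/eqP => e0; move: e1; rewrite /vnorm e0 big1.
  by rewrite sqrtr0 => /esym/eqP; rewrite oner_eq0.
by move=> i _; rewrite mxE expr0n.
Qed.

Lemma nonzero_notin_cols0 x e : e != 0 -> e \notin colspan (cols x 0).
Proof.
apply: contra; have := dim_colspan_leq (cols x 0).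
by rewrite leqn0 dimv_eq0 => /eqP ->; rewrite memv0.
Qed.

(** Without a break down the orthogonalized vector lies in [S] but outside the previous span, and
    [x i.+1] is a nonzero multiple of it. *)
Lemma generate_notin_cols x xh i e S :
    (colspan (cols x i) <= S)%VS -> e \in S ->
    generate x xh i e -> ~ breakdown x xh i ->
  x i.+1 \in S /\ x i.+1 \notin colspan (cols x i).
Proof.
move=> xS eS [xhE [al alE _]]; rewrite -xhE in eS.
rewrite /breakdown -mem_orth.
have oS : orth x i (xh i.+1) \in S.
  by rewrite /orth -mulmxA memvB // (subvP xS) // mulmx_colspan.
(* If [al] were 0, the orthogonalized vector would be 0, which lies in every subspace. *)
move/negP => oN; have al0 : al != 0.
  by apply: contraNneq oN => al0; rewrite -alE al0 scale0r mem0v.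
by move: oS oN; rewrite -alE !rpredZeq (negPf al0).
Qed.

(* A strictly increasing chain of subspaces of S of length dim S ends at S. *)
Lemma colspan_cols_eq x S :
    (forall i, (i < \dim S)%N -> (colspan (cols x i) <= S)%VS ->
       x i.+1 \in S /\ x i.+1 \notin colspan (cols x i)) ->
  colspan (cols x (\dim S)) = S.
Proof.
move=> step.
suff chain i : (i <= \dim S)%N ->
    (colspan (cols x i) <= S)%VS /\ (i <= \dim (colspan (cols x i)))%N.
  by have [// | sub dimS] := chain (\dim S); apply/eqP; rewrite eqEdim sub.
elim: i => [|i IHi] iS; first by split=> //; apply: colspan_cols_subv.
have [sub dimi] := IHi (ltnW iS); have [xS xN] := step i iS sub.
split.
  apply: colspan_cols_subv => j; rewrite ltnS leq_eqVlt => /predU1P[-> // | ji].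
  exact: (subvP sub) (mem_colspan_cols x ji).
have subS : (colspan (cols x i) <= colspan (cols x i.+1))%VS.
  by apply: colspan_cols_subv => j ji; rewrite mem_colspan_cols // ltnW.
(* Nested subspaces of equal dimension coincide, which would put [x i.+1] into the span of its
   predecessors. *)
apply: leq_ltn_trans dimi _; rewrite (ltn_leqif (dimv_leqif_eq subS)).
by apply: contra xN => /eqP ->; rewrite mem_colspan_cols.
Qed.

(** The form in which all three modes use the chain argument. The first vector has its own
    hypothesis, because it is given in modes 1 and 2 but generated in mode 3. *)
Lemma generated_colspan x xh S k :
    \dim S = k ->
    (0 < k -> x 1%N \in S /\ x 1%N \notin colspan (cols x 0))%N ->
    (forall i, (0 < i < k)%N -> exists2 e, e \in S & generate x xh i e) ->
    (forall i, (0 < i < k)%N ->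
       breakdown x xh i -> colspan (cols x i) = S) ->
  colspan (cols x (k)) = S.
Proof.
move=> <- start gen brk; apply: colspan_cols_eq => -[|i] iS sub.
  exact: start.
have [e eS ge] := gen i.+1 iS; apply: generate_notin_cols ge _ => //.
(* A break down would make [i.+1] columns span [S], whose dimension is larger. *)
move/(brk i.+1 iS) => cS; have := dim_colspan_leq (cols x i.+1).
by rewrite cS leqNgt iS.
Qed.

End Colspan.

Section Ranges.
Variables (R : realType) (l m n : nat) (A : tensor R l m n).

Lemma contract23_range1 v w : contract23 A v w \in Defs.range1 A.
Proof.
have -> : contract23 A v w = \sum_j \sum_k (v j 0 * w k 0) *: fibre1 A j k.
  apply/colP=> i; rewrite mxE summxE; apply: eq_bigr => j _.
  by rewrite summxE; apply: eq_bigr => k _; rewrite !mxE -mulrA mulrC.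
apply: memv_suml => j _; apply: memv_suml => k _; rewrite memvZ // memv_span //.
by apply/imageP; exists (j, k).
Qed.

Lemma contract13_range2 u w : contract13 A u w \in range2 A.
Proof.
have -> : contract13 A u w = \sum_i \sum_k (u i 0 * w k 0) *: fibre2 A i k.
  apply/colP=> j; rewrite mxE summxE; apply: eq_bigr => i _.
  by rewrite summxE; apply: eq_bigr => k _; rewrite !mxE -mulrA mulrC.
apply: memv_suml => i _; apply: memv_suml => k _; rewrite memvZ // memv_span //.
by apply/imageP; exists (i, k).
Qed.

Lemma contract12_range3 u v : contract12 A u v \in range3 A.
Proof.
have -> : contract12 A u v = \sum_i \sum_j (u i 0 * v j 0) *: fibre3 A i j.
  apply/colP=> k; rewrite mxE summxE; apply: eq_bigr => i _.
  by rewrite summxE; apply: eq_bigr => j _; rewrite !mxE -mulrA mulrC.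
apply: memv_suml => i _; apply: memv_suml => j _; rewrite memvZ // memv_span //.
by apply/imageP; exists (i, j).
Qed.

Variables (p q r : nat) (C : tensor R p q r).
Variables (X : 'M[R]_(l, p)) (Y : 'M[R]_(m, q)) (Z : 'M[R]_(n, r)).

(** Each fibre is [X] times a vector, which gives one inclusion. Equality follows by dimension,
    since [p] columns span at most dimension [p]. *)
Lemma range1_tmul : A = tmul X Y Z C -> \dim (Defs.range1 A) = p ->
  Defs.range1 A = colspan X.
Proof.
move=> hA dimA; apply/eqP; rewrite eqEdim dimA dim_colspan_leq andbT.
apply/span_subvP => _ /imageP[[j k] _ ->].
have -> : fibre1 A j k =
    X *m \col_a \sum_b \sum_c Y j b * Z k c * C (a, b, c).
  apply/colP=> i; rewrite hA !mxE ffunE; apply: eq_bigr => a _.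
  rewrite mxE mulr_sumr; apply: eq_bigr => b _.
  by rewrite mulr_sumr; apply: eq_bigr => c _; rewrite !mulrA.
exact: mulmx_colspan.
Qed.

Lemma range2_tmul : A = tmul X Y Z C -> \dim (range2 A) = q ->
  range2 A = colspan Y.
Proof.
move=> hA dimA; apply/eqP; rewrite eqEdim dimA dim_colspan_leq andbT.
apply/span_subvP => _ /imageP[[i k] _ ->].
have -> : fibre2 A i k =
    Y *m \col_b \sum_a \sum_c X i a * Z k c * C (a, b, c).
  apply/colP=> j; rewrite hA !mxE ffunE exchange_big; apply: eq_bigr => b _.
  rewrite mxE mulr_sumr; apply: eq_bigr => a _.
  by rewrite mulr_sumr; apply: eq_bigr => c _; rewrite !mulrA (mulrC (X i a)).
exact: mulmx_colspan.
Qed.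

Lemma range3_tmul : A = tmul X Y Z C -> \dim (range3 A) = r ->
  range3 A = colspan Z.
Proof.
move=> hA dimA; apply/eqP; rewrite eqEdim dimA dim_colspan_leq andbT.
apply/span_subvP => _ /imageP[[i j] _ ->].
have -> : fibre3 A i j =
    Z *m \col_c \sum_a \sum_b X i a * Y j b * C (a, b, c).
  apply/colP=> k; rewrite hA !mxE ffunE.
  (* Two exchanges, first of [b] and [c], then of [a] and [c], bring the sum over [c] to the
     outside. *)
  under eq_bigr => a _ do rewrite exchange_big.
  rewrite exchange_big; apply: eq_bigr => c _.
  rewrite mxE mulr_sumr; apply: eq_bigr => a _.
  rewrite mulr_sumr; apply: eq_bigr => b _ /=.
  by rewrite mulrA (mulrC (Z k c)).
exact: mulmx_colspan.
Qed.

End Ranges.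

Theorem theorem3 (R : realType) (l m n p q r : nat)
    (A : tensor R l m n) (C : tensor R p q r)
    (X : 'M[R]_(l, p)) (Y : 'M[R]_(m, q)) (Z : 'M[R]_(n, r))
    (u uh : nat -> 'cV[R]_l) (v vh : nat -> 'cV[R]_m) (w wh : nat -> 'cV[R]_n)
    (hrank : multilinear_rank A = (p, q, r))
    (hpq : (p <= q)%N) (hqr : (q <= r)%N)
    (hA : A = tmul X Y Z C)
    (hX : \rank X = p) (hY : \rank Y = q) (hZ : \rank Z = r)
    (hu1 : u 1%N \in colspan X) (hv1 : v 1%N \in colspan Y)
    (hw1 : w 1%N \in colspan Z)
    (hrun : modified_minimal_krylov A p q r u uh v vh w wh)
    (hbreak : no_premature_breakdown A p q r u uh v vh w wh) :
  [/\ colspan (cols u p) = colspan X,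
      colspan (cols v q) = colspan Y &
      colspan (cols w r) = colspan Z].
Proof.
case: hrank => dim1 dim2 dim3.
have E1 := range1_tmul hA dim1; have E2 := range2_tmul hA dim2.
(* From here on the targets are the range spaces, which are also the ones named in the break down
   hypothesis. *)
have E3 := range3_tmul hA dim3; rewrite -E1 -E2 -E3.
case: hrun => -[u1 v1 gw0 run1] run2 run3; case: hbreak => bu bv bw.
split.
- apply: (generated_colspan (xh := uh) dim1) => // [_|i ip].
    by rewrite E1; split=> //; apply/nonzero_notin_cols0/vnorm1_neq0.
  have [gu _ _] := run1 i ip.
  by exists (contract23 A (v i) (w i)); rewrite ?contract23_range1.
- apply: (generated_colspan (xh := vh) dim2) => // [_|i].
    by rewrite E2; split=> //; apply/nonzero_notin_cols0/vnorm1_neq0.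
  (* The phase of the method decides which product yields [v i.+1]; only its membership in the range
     space matters. *)
  case/andP=> i0 iq; have [ip|pi] := ltnP i p.
    have [|_ gv _] := run1 i; first by rewrite i0.
    by exists (contract13 A (u i.+1) (w i)); rewrite ?contract13_range2.
  have [|ub [ub' [_ _ gv _]]] := run2 i; first by rewrite pi.
  by exists (contract13 A ub (w i)); rewrite ?contract13_range2.
- apply: (generated_colspan (xh := wh) dim3) => // [r0|i|i].
  (* Here [w 1] comes from a product: a break down at index 0 would make the span of no columns
     equal to a range space of dimension [r > 0]. *)
  + apply: generate_notin_cols gw0 _; rewrite ?contract12_range3 //.
      by apply: colspan_cols_subv.
    move/(bw 0%N r0) => c0; have := dim_colspan_leq (cols w 0).
    by rewrite c0 dim3 leqNgt r0.
  + case/andP=> i0 ir; have [ip|pi] := ltnP i p.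
      have [|_ _ gw] := run1 i; first by rewrite i0.
      by exists (contract12 A (u i.+1) (v i.+1)); rewrite ?contract12_range3.
    have [iq|qi] := ltnP i q.
      have [|ub [ub' [_ _ _ gw]]] := run2 i; first by rewrite pi.
      by exists (contract12 A ub' (v i.+1)); rewrite ?contract12_range3.
    have [|ub [vb [_ _ gw]]] := run3 i; first by rewrite qi.
    by exists (contract12 A ub vb); rewrite ?contract12_range3.
  + by case/andP=> _; apply: bw.
Qed.
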